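(* Let $d\ge1$, $G\in\mathrm{GL}_{1+d}(\mathbb{R})$, $\gamma=(\gamma_0,\boldsymbol{\pi}\gamma)\in\mathbb{R}^{1+d}$, and let $g(\xi)=\boldsymbol{\pi}({}^tG\sigma(\xi))$ for $\|\xi\|<1$. (i) The canonical relation of the Fourier integral operator $U_G$ (the case $\gamma=0$) in the region $\|\xi\|<1$ is the set $\{(\tilde x, g(\xi);\ {}^t dg(\xi)\,\tilde x,\ \xi): \tilde x\in\mathbb{R}^d,\ \xi\in\mathbb{R}^d,\ \|\xi\|<1\}$ (written as (target point; source point)). Near any $\xi$ with $\sigma(\xi)\notin G\mathcal{P}_0$ this defines a canonical transformation $\kappa_{U_G}(x,\xi)=\big(({}^t dg(\xi))^{-1}x,\ g(\xi)\big)$. (ii) Let $S(\xi)=\langle\gamma,\sigma(\xi)\rangle$. The canonical transformation of $U_\gamma:=U_{\tau_\gamma}$ (the case $G=\mathrm{Id}$) is $\kappa_{U_\gamma}(x,\xi)=(x-dS(\xi),\xi)=\Big(x+\frac{\gamma_0\xi}{\sqrt{1-\|\xi\|^2}}-\boldsymbol{\pi}\gamma,\ \xi\Big)$. (iii) For the affine map $\mathcal{G}=\tau_\gamma\circ G$, i.e. $\mathcal{G}(\tilde X)=G\tilde X+\gamma$, the canonical transformation of $U_{\mathcal{G}}$ is $(\tilde x,\tilde\xi)=\kappa_{U_{\mathcal{G}}}(x,\xi)$ with $\tilde\xi=g(\xi)$ and $\tilde x=({}^tdg(\xi))^{-1}x-({}^tdg(\xi))^{-1}dS(\xi)$, and $\kappa_{U_{\mathcal{G}}}=\kappa_{U_G}\circ\kappa_{U_\gamma}$.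 (iv) The map $\kappa_{U_\gamma}$ is a symplectomorphism from $\mathbb{R}^d\times B(0,1)$ onto itself, while $\kappa_{U_G}$ extends to two injective symplectomorphisms from $\mathbb{R}^d\times D_+$ and from $\mathbb{R}^d\times D_-$ onto their respective images.
   Context: Notation: $\mathbb{R}^{1+d}$ with canonical basis $e_0,\dots,e_d$ and scalar product $\langle\cdot,\cdot\rangle$; $\langle\cdot,\cdot\rangle_d$ on $\mathbb{R}^d$; $\boldsymbol{\pi}:\mathbb{R}^{1+d}\to\mathbb{R}^d$ drops the first coordinate; $\sigma(\xi)=(\sqrt{1-\|\xi\|^2},\xi)$; $\mathcal{P}_0=\{\xi_0=0\}$; $\tau_\gamma(X)=X+\gamma$; ${}^t$ denotes transpose. $\mathcal{F}_\hbar\psi(\xi)=\int e^{-\frac{i}{\hbar}\langle x,\xi\rangle_d}\psi(x)dx$. For an affine map $\mathcal{G}$ and $\tilde X=(0,\tilde x)$, $[U_{\mathcal{G}}\psi](\tilde x)=\frac{1}{(2\pi\hbar)^d}\int\!\!\int e^{\frac{i}{\hbar}\Phi(\tilde x,\xi,x)}\psi(x)\,dx\,d\xi$ with phase $\Phi(\tilde x,\xi,x)=\langle\mathcal{G}\tilde X,\sigma(\xi)\rangle-\langle x,\xi\rangle_d$, $\xi$ being the auxiliary variable; its canonical relation is $\{(\tilde x,\partial_{\tilde x}\Phi;\ x,-\partial_x\Phi): \partial_\xi\Phi=0\}$, and when this is locally a graph, $\kappa_{U_{\mathcal{G}}}$ denotes the map from source point $(x,-\partial_x\Phi)$ to target point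 $(\tilde x,\partial_{\tilde x}\Phi)$. The symplectic form on $T^*\mathbb{R}^d$ is $d\xi\wedge dx$. With $a={}^tG^{-1}e_0$, for $\epsilon\in\{+,-\}$, $D_\epsilon=\{\xi\in\mathbb{R}^d:\|\xi\|<1,\ \langle\sigma(\xi),a\rangle\in\epsilon(0,+\infty)\}$. *)

(* Defs.v *)
(* Vectors of R^n are column vectors 'cV[R]_n;
   R^{1+d} is 'cV[R]_(1+d), first block = coordinate 0, second block = the
   last d coordinates.  A point of T^*R^d is a pair (x, xi). *)
From mathcomp Require Import all_boot all_order all_algebra.
From mathcomp Require Import all_classical all_reals all_analysis.
Import numFieldNormedType.Exports.
Import Order.TTheory GRing.Theory Num.Theory.
Set Implicit Arguments. Unset Strict Implicit. Unset Printing Implicit Defensive.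
Local Open Scope ring_scope.
Local Open Scope classical_set_scope.

Section Defs.
Variable R : realType.

Definition dotp n (u v : 'cV[R]_n) : R := (u^T *m v) 0 0.
Definition enorm n (u : 'cV[R]_n) : R := Num.sqrt (dotp u u).
Definition unit_ball n : set 'cV[R]_n := [set xi | enorm xi < 1].

Definition sigma d (xi : 'cV[R]_d) : 'cV[R]_(1 + d) :=
  col_mx (Num.sqrt (1 - dotp xi xi))%:M xi.
Definition piv d (X : 'cV[R]_(1 + d)) : 'cV[R]_d := dsubmx X.
Definition emb d (x : 'cV[R]_d) : 'cV[R]_(1 + d) := col_mx 0 x.
Definition first_coord d (X : 'cV[R]_(1 + d)) : R := usubmx X 0 0.
Definition e0 d : 'cV[R]_(1 + d) := col_mx 1%:M 0.
Definition P0 d : set 'cV[R]_(1 + d) := [set X | first_coord X = 0].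
Definition GP0 d (G : 'M[R]_(1 + d)) : set 'cV[R]_(1 + d) := [set G *m X | X in @P0 d].

Definition partial n (V : normedModType R) (f : 'cV[R]_n -> V) p (i : 'I_n) : V :=
  derive f p (delta_mx i 0).
Definition grad n (f : 'cV[R]_n -> R) (p : 'cV[R]_n) : 'cV[R]_n :=
  \col_i partial f p i.
Definition jac n m (f : 'cV[R]_n -> 'cV[R]_m) (p : 'cV[R]_n) : 'M[R]_(m, n) :=
  \matrix_(i, j) (partial f p j) i 0.

Definition gmap d (G : 'M[R]_(1 + d)) (xi : 'cV[R]_d) : 'cV[R]_d := piv (G^T *m sigma xi).
Definition Sfun d (gam : 'cV[R]_(1 + d)) (xi : 'cV[R]_d) : R := dotp gam (sigma xi).

(* phase of U_calG for the affine map calG X = M X + c :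
   Phi(xt, xi, x) = <calG (0,xt), sigma xi> - <x, xi> *)
Definition phase d (M : 'M[R]_(1 + d)) (c : 'cV[R]_(1 + d)) (xt xi x : 'cV[R]_d) : R :=
  dotp (M *m emb xt + c) (sigma xi) - dotp x xi.

(* canonical relation (target point ; source point), in the region |xi| < 1:
   {(xt, d_xt Phi ; x, - d_x Phi) : d_xi Phi = 0} *)
Definition CanRel d (M : 'M[R]_(1 + d)) (c : 'cV[R]_(1 + d)) :
  set (('cV[R]_d * 'cV[R]_d) * ('cV[R]_d * 'cV[R]_d)) :=
  [set q | exists xt xi x, enorm xi < 1 /\
     grad (fun z => phase M c xt z x) xi = 0 /\
     q = ((xt, grad (fun y => phase M c y xi x) xt),
          (x, - grad (fun y => phase M c xt xi y) x))].

Definition graph_on d (C : set (('cV[R]_d * 'cV[R]_d) * ('cV[R]_d * 'cV[R]_d)))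
  (kappa : 'cV[R]_d * 'cV[R]_d -> 'cV[R]_d * 'cV[R]_d) (A : set ('cV[R]_d * 'cV[R]_d)) :=
  forall p, A p -> forall t, C (t, p) <-> t = kappa p.

Definition kappaG d (G : 'M[R]_(1 + d)) (p : 'cV[R]_d * 'cV[R]_d) : 'cV[R]_d * 'cV[R]_d :=
  (invmx (jac (gmap G) p.2)^T *m p.1, gmap G p.2).
Definition kappaGam d (gam : 'cV[R]_(1 + d)) (p : 'cV[R]_d * 'cV[R]_d) : 'cV[R]_d * 'cV[R]_d :=
  (p.1 - grad (Sfun gam) p.2, p.2).

Definition Dset d (G : 'M[R]_(1 + d)) (eps : bool) : set 'cV[R]_d :=
  [set xi | enorm xi < 1 /\
     let s := dotp (sigma xi) (invmx G^T *m @e0 d) in if eps then 0 < s else s < 0].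

(* symplectic form d xi /\ d x on tangent vectors (dx, dxi) *)
Definition omega d (w1 w2 : 'cV[R]_d * 'cV[R]_d) : R :=
  dotp w1.2 w2.1 - dotp w2.2 w1.1.

(* C^k and C^infinity on a set (used on open sets) *)
Fixpoint Ck (V W : normedModType R) (k : nat) (A : set V) (f : V -> W) : Prop :=
  match k with
  | 0 => {within A, continuous f}
  | k'.+1 => (forall p, A p -> differentiable f p) /\
             forall v : V, Ck k' A (fun p => derive f p v)
  end.
Definition smooth_on (V W : normedModType R) (A : set V) (f : V -> W) :=
  forall k, Ck k A f.

Definition symplectic_on d (A : set ('cV[R]_d * 'cV[R]_d))
  (kappa : 'cV[R]_d * 'cV[R]_d -> 'cV[R]_d * 'cV[R]_d) :=
  forall p, A p -> forall w1 w2,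
    omega (derive kappa p w1) (derive kappa p w2) = omega w1 w2.

Definition symplecto_onto d (A B : set ('cV[R]_d * 'cV[R]_d))
  (kappa : 'cV[R]_d * 'cV[R]_d -> 'cV[R]_d * 'cV[R]_d) :=
  open A /\ open B /\ (forall p, A p -> B (kappa p)) /\
  smooth_on A kappa /\ symplectic_on A kappa /\
  exists h, smooth_on B h /\ (forall q, B q -> A (h q)) /\
     (forall p, A p -> h (kappa p) = p) /\ (forall q, B q -> kappa (h q) = q).

End Defs.
Arguments unit_ball {R} n.

(* Main.v *)
(** The derivative of [sigma] at [xi] takes values in the hyperplane orthogonal to
    [sigma xi], and its transpose sends [Y] to [piv Y - (Y_0 / rho) *: xi], where
    [rho = sqrt (1 - |xi|^2)].  Stationarity of the phase in [xi] therefore reads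
    [x = dsigma^T (G (0, xt) + gam)], from which the canonical relations are read off.
    Everything is inverted by closed formulas.  With [a = G^-T e_0], the equation
    [x = dsigma^T (G (0, y))] is solved by the only vector of [(0, x) + R sigma(xi)]
    orthogonal to [a], which exists when [<a, sigma xi> <> 0].  The map [gmap] is
    inverted by intersecting the line [G^-T (0, eta) + R a] with the unit sphere: the
    sign of [<sigma xi, a>] selects the root of the quadratic equation, and this gives
    injectivity on [Dset], openness of the image and smoothness of the inverse.
    Symplecticity follows by differentiating [x = dsigma^T (G (0, y))]: the second
    derivatives only contribute a symmetric bilinear form. *)
From HB Require Import structures.
Require Import Defs.
From mathcomp Require Import all_boot all_order all_algebra.
From mathcomp Require Import all_classical all_reals all_analysis.
From mathcomp Require Import ring.
Import numFieldNormedType.Exports.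
Import Order.TTheory GRing.Theory Num.Theory.
Local Open Scope ring_scope.
Local Open Scope classical_set_scope.
Set Implicit Arguments. Unset Strict Implicit. Unset Printing Implicit Defensive.

(** * Differentials of elementary operations on normed modules *)

Section Differentials.
Context {R : realType}.
Implicit Types V W U : normedModType R.

Lemma is_diff_derive V W (f df : V -> W) p v : is_diff p f df -> derive f p v = df v.
Proof. by move=> h; rewrite deriveE ?diff_val. Qed.

(** The linear structure is packed on the fly from a proof of linearity, so that plain functions
    such as [piv] and [emb] can be used without a declared structure. *)
Lemma is_diff_lin V W (L : V -> W) p : linear L -> continuous L -> is_diff p L L.
Proof.
move=> linL cL.
pose M := GRing.isLinear.Build _ _ _ _ _ linL.
pose F : {linear _ -> _} := HB.pack L M.
have cF : continuous F by [].
by split; [exact: (@linear_differentiable _ _ _ F)|exact: (@diff_lin _ _ _ F)].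
Qed.

Lemma is_diff_fun_cst V W (w : W) (p : V) : is_diff p (fun=> w) (fun=> 0).
Proof. exact: is_diff_cst. Qed.

Lemma is_diff_fun_add V W (f g df dg : V -> W) p :
  is_diff p f df -> is_diff p g dg ->
  is_diff p (fun z => f z + g z) (fun v => df v + dg v).
Proof. exact: is_diffD. Qed.

Lemma is_diff_fun_sub V W (f g df dg : V -> W) p :
  is_diff p f df -> is_diff p g dg ->
  is_diff p (fun z => f z - g z) (fun v => df v - dg v).
Proof. exact: is_diffB. Qed.

Lemma is_diff_compL V W U (L : W -> U) (f df : V -> W) p :
  linear L -> continuous L -> is_diff p f df ->
  is_diff p (fun z => L (f z)) (fun v => L (df v)).
Proof. by move=> lL cL df_; apply: (is_diff_comp df_ (is_diff_lin _ lL cL)). Qed.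

Lemma scale_is_bilinear W :
  bilinear_for
    (GRing.Scale.Law.clone _ _ *:%R _) (GRing.Scale.Law.clone _ _ *:%R _)
    (fun (r : R) (w : W) => r *: w).
Proof.
split=> [u|u] a x y /=; first by rewrite scalerDl -scalerA.
by rewrite scalerDr !scalerA [a * u]mulrC.
Qed.

(** Chain rule through the pair [(f, g)], scaling being a continuous bilinear map. *)
Lemma is_diff_scale V W (f df : V -> R) (g dg : V -> W) p :
  is_diff p f df -> is_diff p g dg ->
  is_diff p (fun z => f z *: g z) (fun v => f p *: dg v + df v *: g p).
Proof.
move=> hf hg.
pose M := bilinear_isBilinear.Build R R W W _ _ _ (scale_is_bilinear W).
pose B : {bilinear R -> W -> W} := HB.pack (fun (r : R) (w : W) => r *: w) M.
have cB : continuous (fun q => B q.1 q.2) by exact: scale_continuous.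
have hB : is_diff (f p, g p) (fun q => B q.1 q.2)
    (fun q => B (f p, g p).1 q.2 + B q.1 (f p, g p).2).
  by split; [exact: differentiable_bilin | rewrite diff_bilin].
exact: (is_diff_comp (is_diff_pair hf hg) hB).
Qed.

Lemma is_diff_inv V (f df : V -> R) p : f p != 0 -> is_diff p f df ->
  is_diff p (fun z => (f z)^-1) (fun v => - (f p) ^- 2 * df v).
Proof.
move=> fp0 h; split; first exact: differentiableV.
by rewrite diffV// diff_val.
Qed.

Lemma is_diff_sqrt V (f df : V -> R) p : 0 < f p -> is_diff p f df ->
  is_diff p (fun z => Num.sqrt (f z)) (fun v => (2 * Num.sqrt (f p))^-1 * df v).
Proof.
move=> fp0 h.
have hs : is_diff (f p) (@Num.sqrt R) (fun v => (2 * Num.sqrt (f p))^-1 * v).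
  have [d e] := is_derive1_sqrt fp0.
  have ds : differentiable (@Num.sqrt R) (f p) by apply/derivable1_diffP.
  split=> //; apply/funext => v.
  (* By linearity a differential on the line is determined at [1], where it is the one-variable
     derivative. *)
  have -> : v = v *: (1 : R) by rewrite [RHS]mulr1.
  rewrite linearZ -deriveE// e.
  by rewrite [RHS]mulrC [_ *: 1]mulr1.
exact: (is_diff_comp h hs).
Qed.

(** Both functions have the same remainder near [p], so the little-o expansion of [f] is one of [g];
    uniqueness of the differential concludes. *)
Lemma near_eq_is_diff V W (f g df : V -> W) p :
  (\near p, f p = g p) -> is_diff p f df -> is_diff p g df.
Proof.
move=> fg hf.
have [cf ef] := (diff_locallyP p f).1 ex_diff.
have eg : g \o shift p = cst (g p) + 'd f p +o_ 0 id.
  apply/eqaddoP => e e0.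
  move/eqaddoP: ef => /(_ e e0) ef.
  rewrite -(nbhs_singleton fg).
  have fg0 : \forall h \near (0 : V), g (h + p) = f (h + p).
    rewrite (near_shift p); apply: filterS fg => q /=.
    by rewrite sub0r subrK.
  near=> h.
  suff -> : (g \o shift p - (cst (f p) + 'd f p)) h
    = (f \o shift p - (cst (f p) + 'd f p)) h by near: h.
  by rewrite [LHS]/GRing.add [RHS]/GRing.add /=; congr (_ + _); near: h.
have ed : 'd g p = 'd f p :> (V -> W) by apply: diff_unique.
split; last by rewrite ed diff_val.
by apply/diff_locallyP; rewrite ed.
Unshelve. all: by end_near. Qed.

(** Expanding along the canonical basis gives a finite sum of continuous coordinates times fixed
    vectors. *)
Lemma linear_cV_continuous n W (L : 'cV[R]_n -> W) : linear L -> continuous L.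
Proof.
move=> linL.
pose M := GRing.isLinear.Build _ _ _ _ _ linL.
pose F : {linear _ -> _} := HB.pack L M.
have -> : L = fun x => \sum_i x i 0 *: F (delta_mx i 0).
  apply/funext => x; rewrite -[L x]/(F x) [x in LHS]matrix_sum_delta linear_sum.
  by apply: eq_bigr => i _; rewrite big_ord1 linearZ.
move=> x; apply: cvg_big => [||i _]; [exact: add_continuous|exact: nbhs_filter|].
by apply: cvgZr_tmp; [exact: nbhs_filter|exact: coord_continuous].
Qed.
End Differentials.

(** * Closure properties of the classes [Ck] on open sets *)

Section Smooth.
Context {R : realType}.
Implicit Types V W U : normedModType R.

(** Openness turns equality on [A] into equality near each point of [A], so the derivatives also
    agree on [A] and the induction proceeds. *)
Lemma Ck_eq V W k (A : set V) (f g : V -> W) : open A ->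
  (forall p, A p -> f p = g p) -> Ck k A f -> Ck k A g.
Proof.
move=> oA; elim: k f g => [|k IH] f g fg /=.
  by apply: subspace_eq_continuous => p /set_mem; apply: fg.
have nfg p : A p -> \near p, f p = g p.
  by move=> Ap; near do apply: fg; exact: open_nbhs_nbhs.
move=> [df Df]; split=> [p Ap|v].
  by have [] := near_eq_is_diff (nfg _ Ap) (differentiableP (df _ Ap)).
by apply: IH (Df v) => p Ap; apply: near_eq_derive; exact: nfg.
Unshelve. all: by end_near. Qed.

Lemma Ck0P V W (A : set V) (f : V -> W) : open A ->
  Ck 0 A f <-> forall p, A p -> {for p, continuous f}.
Proof.
move=> oA; rewrite /= continuous_open_subspace//.
by split=> h p => [Ap|/set_mem]; apply: h => //; apply/mem_set.
Qed.

(** Induction step shared by the closure lemmas: an explicit differential, valid only on [A], stands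
    in for [derive]. *)
Lemma Ck_is_diff V W k (A : set V) (f : V -> W) (df : V -> V -> W) : open A ->
  (forall p, A p -> is_diff p f (df p)) ->
  (forall v, Ck k A (df ^~ v)) -> Ck k.+1 A f.
Proof.
move=> oA hf hd; split=> [p /hf[]//|v].
apply: Ck_eq (hd v) => // p /hf h; exact/esym/is_diff_derive.
Qed.

Lemma CkS_is_diff V W k (A : set V) (f : V -> W) p :
  Ck k.+1 A f -> A p -> is_diff p f (derive f p).
Proof.
move=> [df _] Ap; split; first exact: df.
by apply/funext => v; rewrite deriveE//; exact: df.
Qed.

Lemma CkW V W k (A : set V) (f : V -> W) : open A -> Ck k.+1 A f -> Ck k A f.
Proof.
move=> oA; elim: k f => [|k IH] f [df Df].
  by apply/Ck0P => // p Ap; apply/differentiable_continuous/df.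
by split=> // v; apply: IH; exact: Df.
Qed.

Lemma Ck_cst V W k (A : set V) (w : W) : Ck k A (fun=> w).
Proof.
elim: k w => [|k IH] w; first exact: cst_continuous.
by split=> [p _|v]; [exact: differentiable_cst | under eq_fun do rewrite derive_cst].
Qed.

Lemma Ck_lin V W U k (A : set V) (L : W -> U) (f : V -> W) : open A ->
  linear L -> continuous L -> Ck k A f -> Ck k A (fun p => L (f p)).
Proof.
move=> oA lL cL; elim: k f => [|k IH] f hf.
  apply/Ck0P => // p Ap; apply: continuous_comp; last exact: cL.
  by move: p Ap; exact/Ck0P.
apply: (@Ck_is_diff _ _ _ _ _ (fun p v => L (derive f p v))) => // [p Ap|v].
  by apply: is_diff_compL => //; exact: CkS_is_diff hf Ap.
by apply: IH; exact: hf.2.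
Qed.

Lemma CkD V W k (A : set V) (f g : V -> W) : open A ->
  Ck k A f -> Ck k A g -> Ck k A (fun p => f p + g p).
Proof.
move=> oA; elim: k f g => [|k IH] f g hf hg.
  by apply/Ck0P => // p Ap; apply: cvgD; move: p Ap; exact/Ck0P.
apply: (@Ck_is_diff _ _ _ _ _ (fun p v => derive f p v + derive g p v)) => // [p Ap|v].
  exact: is_diffD (CkS_is_diff hf Ap) (CkS_is_diff hg Ap).
by apply: IH; [exact: hf.2|exact: hg.2].
Qed.

Lemma CkZ V W k (A : set V) (f : V -> R) (g : V -> W) : open A ->
  Ck k A f -> Ck k A g -> Ck k A (fun p => f p *: g p).
Proof.
move=> oA; elim: k f g => [|k IH] f g hf hg.
  by apply/Ck0P => // p Ap; apply: cvgZ; move: p Ap; exact/Ck0P.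
apply: (@Ck_is_diff _ _ _ _ _
  (fun p v => f p *: derive g p v + derive f p v *: g p)) => // [p Ap|v].
  exact: is_diff_scale (CkS_is_diff hf Ap) (CkS_is_diff hg Ap).
by apply: CkD => //; apply: IH; [exact: CkW|exact: hg.2|exact: hf.2|exact: CkW].
Qed.

Lemma CkM V k (A : set V) (f g : V -> R) : open A ->
  Ck k A f -> Ck k A g -> Ck k A (fun p => f p * g p).
Proof. exact: CkZ. Qed.

(** The derivative of the inverse contains the inverse itself, which the induction hypothesis covers
    one order lower; [Ck_sqrt] follows the same pattern. *)
Lemma CkV V k (A : set V) (f : V -> R) : open A ->
  (forall p, A p -> f p != 0) -> Ck k A f -> Ck k A (fun p => (f p)^-1).
Proof.
move=> oA f0; elim: k => [|k IH] hf.
  apply/Ck0P => // p Ap; apply: cvgV; first exact: f0.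
  by move: p Ap; exact/Ck0P.
apply: (@Ck_is_diff _ _ _ _ _ (fun p v => - (f p) ^- 2 * derive f p v)) => // [p Ap|v].
  exact: is_diff_inv (f0 _ Ap) (CkS_is_diff hf Ap).
have hV := IH (CkW oA hf).
apply: CkM => //; last exact: hf.2.
(* The factor [- (f p) ^- 2] is rewritten as a product of inverses to reuse [hV]. *)
apply: (@Ck_eq _ _ _ _ (fun p => (-1) * ((f p)^-1 * (f p)^-1))) => // [p Ap|].
  by rewrite mulN1r -invfM.
by apply: CkM; [|exact: Ck_cst|exact: CkM].
Qed.

Lemma Ck_sqrt V k (A : set V) (f : V -> R) : open A ->
  (forall p, A p -> 0 < f p) -> Ck k A f -> Ck k A (fun p => Num.sqrt (f p)).
Proof.
move=> oA f0; elim: k => [|k IH] hf.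
  apply/Ck0P => // p Ap; apply: continuous_comp; last exact: sqrt_continuous.
  by move: p Ap; exact/Ck0P.
apply: (@Ck_is_diff _ _ _ _ _
  (fun p v => (2 * Num.sqrt (f p))^-1 * derive f p v)) => // [p Ap|v].
  exact: is_diff_sqrt (f0 _ Ap) (CkS_is_diff hf Ap).
apply: CkM => //; last exact: hf.2.
apply: CkV => // [p Ap|].
  by rewrite mulf_neq0// gt_eqF// sqrtr_gt0 f0.
by apply: CkM; [|exact: Ck_cst|exact/IH/CkW].
Qed.

Lemma Ck_pair V W U k (A : set V) (f : V -> W) (g : V -> U) : open A ->
  Ck k A f -> Ck k A g -> Ck k A (fun p => (f p, g p)).
Proof.
move=> oA; elim: k f g => [|k IH] f g hf hg.
  by apply/Ck0P => // p Ap; apply: cvg_pair; move: p Ap; exact/Ck0P.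
apply: (@Ck_is_diff _ _ _ _ _ (fun p v => (derive f p v, derive g p v))) => // [p Ap|v].
  exact: is_diff_pair (CkS_is_diff hf Ap) (CkS_is_diff hg Ap).
by apply: IH; [exact: hf.2|exact: hg.2].
Qed.

Lemma Ck_id V k (A : set V) : open A -> Ck k A (fun p => p).
Proof.
move=> oA; case: k => [|k]; first by apply/Ck0P => // p _; exact: cvg_id.
apply: (@Ck_is_diff _ _ _ _ _ (fun p v => v)) => // v.
exact: Ck_cst.
Qed.
End Smooth.

(** * Algebra of the scalar product *)

Section Dotp.
Context {R : realType}.

Lemma dotpE n (u v : 'cV[R]_n) : dotp u v = \sum_i u i 0 * v i 0.
Proof. by rewrite /dotp mxE; apply: eq_bigr => i _; rewrite mxE. Qed.

Lemma dotpC n (u v : 'cV[R]_n) : dotp u v = dotp v u.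
Proof. by rewrite !dotpE; apply: eq_bigr => i _; rewrite mulrC. Qed.

Lemma dotp_linear n (u : 'cV[R]_n) : linear (dotp u).
Proof. by move=> a v w; rewrite /dotp mulmxDr -scalemxAr !mxE. Qed.

Lemma dotpDr n (u v w : 'cV[R]_n) : dotp u (v + w) = dotp u v + dotp u w.
Proof. by have := dotp_linear u 1 v w; rewrite !scale1r. Qed.

Lemma dotpZr n a (u v : 'cV[R]_n) : dotp u (a *: v) = a * dotp u v.
Proof. by rewrite /dotp -scalemxAr mxE. Qed.

Lemma dotpNr n (u v : 'cV[R]_n) : dotp u (- v) = - dotp u v.
Proof. by rewrite -scaleN1r dotpZr mulN1r. Qed.

Lemma dotpBr n (u v w : 'cV[R]_n) : dotp u (v - w) = dotp u v - dotp u w.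
Proof. by rewrite dotpDr dotpNr. Qed.

Lemma dotpDl n (u v w : 'cV[R]_n) : dotp (v + w) u = dotp v u + dotp w u.
Proof. by rewrite ![dotp _ u]dotpC dotpDr. Qed.

Lemma dotpZl n a (u v : 'cV[R]_n) : dotp (a *: v) u = a * dotp v u.
Proof. by rewrite ![dotp _ u]dotpC dotpZr. Qed.

Lemma dotpBl n (u v w : 'cV[R]_n) : dotp (v - w) u = dotp v u - dotp w u.
Proof. by rewrite ![dotp _ u]dotpC dotpBr. Qed.

Lemma dotp_mulmx m n (M : 'M[R]_(m, n)) u v : dotp (M *m u) v = dotp u (M^T *m v).
Proof. by rewrite /dotp trmx_mul mulmxA. Qed.

Lemma dotp_delta n (u : 'cV[R]_n) i : dotp u (delta_mx i 0) = u i 0.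
Proof.
rewrite dotpE (bigD1 i)//= mxE !eqxx mulr1 big1 ?addr0// => j ji.
by rewrite mxE (negPf ji) mulr0.
Qed.

Lemma dotp_inj n (u v : 'cV[R]_n) : (forall w, dotp u w = dotp v w) -> u = v.
Proof. by move=> h; apply/colP => i; rewrite -!dotp_delta. Qed.

Lemma dotp_ge0 n (u : 'cV[R]_n) : 0 <= dotp u u.
Proof. by rewrite dotpE sumr_ge0// => i _; exact: sqr_ge0. Qed.

Lemma dotp_eq0 n (u : 'cV[R]_n) : (dotp u u == 0) = (u == 0).
Proof.
apply/eqP/eqP => [|->]; last by rewrite /dotp mulmx0 mxE.
rewrite dotpE => /eqP; rewrite psumr_eq0 => [/allP h|i _]; last exact: sqr_ge0.
apply/colP => i; rewrite mxE; apply/eqP.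
by have := h i; rewrite mem_index_enum mulf_eq0 orbb => /(_ isT).
Qed.

Lemma enorm_sqr n (u : 'cV[R]_n) : enorm u ^+ 2 = dotp u u.
Proof. by rewrite sqr_sqrtr// dotp_ge0. Qed.

Lemma enorm_lt1 n (u : 'cV[R]_n) : (enorm u < 1) = (dotp u u < 1).
Proof. by rewrite /enorm -{1}sqrtr1 ltr_sqrt. Qed.

End Dotp.

(** * The splitting of [R^{1+d}] into first coordinate and remainder *)

Section Coordinates.
Context {R : realType} {d : nat}.
Implicit Types (X Y : 'cV[R]_(1 + d)) (x y xi : 'cV[R]_d).

Lemma piv_linear : linear (@piv R d).
Proof. by move=> a u v; rewrite /piv linearP. Qed.

Lemma emb_linear : linear (@emb R d).
Proof. by move=> a u v; rewrite /emb scale_col_mx add_col_mx scaler0 addr0. Qed.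

Lemma first_coord_linear : linear (@first_coord R d).
Proof. by move=> a u v; rewrite /first_coord linearP !mxE. Qed.

Lemma pivD X Y : piv (X + Y) = piv X + piv Y. Proof. exact: linearD. Qed.
Lemma pivZ a X : piv (a *: X) = a *: piv X. Proof. exact: linearZ. Qed.
Lemma first_coordD X Y : first_coord (X + Y) = first_coord X + first_coord Y.
Proof. by rewrite /first_coord linearD mxE. Qed.
Lemma first_coordZ a X : first_coord (a *: X) = a * first_coord X.
Proof. by rewrite /first_coord linearZ mxE. Qed.
Lemma piv_emb x : piv (emb x) = x. Proof. exact: col_mxKd. Qed.
Lemma first_coord_emb x : first_coord (emb x) = 0.
Proof. by rewrite /first_coord col_mxKu mxE. Qed.
Lemma piv_e0 : piv (@e0 R d) = 0. Proof. exact: col_mxKd. Qed.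
Lemma first_coord_e0 : first_coord (@e0 R d) = 1.
Proof. by rewrite /first_coord col_mxKu mxE. Qed.
Lemma piv_sigma xi : piv (sigma xi) = xi. Proof. exact: col_mxKd. Qed.

Definition rho xi : R := Num.sqrt (1 - dotp xi xi).

Lemma first_coord_sigma xi : first_coord (sigma xi) = rho xi.
Proof. by rewrite /first_coord col_mxKu mxE. Qed.

Lemma first_coordE X : X = first_coord X *: @e0 R d + emb (piv X).
Proof.
rewrite -[LHS]vsubmxK /e0 /emb scale_col_mx add_col_mx scaler0 add0r addr0.
congr col_mx; apply/matrixP => i j; rewrite !ord1 /first_coord !mxE.
by rewrite mulr1.
Qed.

Lemma sigmaE xi : sigma xi = rho xi *: @e0 R d + emb xi.
Proof. by rewrite [LHS]first_coordE first_coord_sigma piv_sigma. Qed.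

Lemma dotp_split X Y :
  dotp X Y = first_coord X * first_coord Y + dotp (piv X) (piv Y).
Proof.
rewrite -[X in LHS]vsubmxK -[Y in LHS]vsubmxK /dotp tr_col_mx mul_row_col mxE.
by congr (_ + _); rewrite mxE big_ord1 mxE.
Qed.

Lemma dotp_embl x X : dotp (emb x) X = dotp x (piv X).
Proof. by rewrite dotp_split first_coord_emb piv_emb mul0r add0r. Qed.

Lemma dotp_e0 X : dotp (@e0 R d) X = first_coord X.
Proof.
rewrite dotp_split first_coord_e0 piv_e0 mul1r.
by rewrite dotpE big1 ?addr0// => i _; rewrite mxE mul0r.
Qed.

Lemma rho_gt0 xi : enorm xi < 1 -> 0 < rho xi.
Proof. by rewrite enorm_lt1 => h; rewrite sqrtr_gt0 subr_gt0. Qed.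

Lemma sqr_rho xi : enorm xi < 1 -> rho xi ^+ 2 = 1 - dotp xi xi.
Proof. by rewrite enorm_lt1 => h; rewrite sqr_sqrtr// subr_ge0 ltW. Qed.

Lemma dotp_sigma xi : enorm xi < 1 -> dotp (sigma xi) (sigma xi) = 1.
Proof.
move=> h; rewrite dotp_split first_coord_sigma piv_sigma -expr2 sqr_rho//.
by rewrite subrK.
Qed.

End Coordinates.

(** * Sums, scalar products, gradients and Jacobians *)

Section Calculus.
Context {R : realType}.
Implicit Types V W : normedModType R.

Lemma is_diff_sum V W n (f df : 'I_n -> V -> W) p :
  (forall i, is_diff p (f i) (df i)) ->
  is_diff p (fun z => \sum_i f i z) (fun v => \sum_i df i v).
Proof.
elim: n f df => [|n IH] f df h.
  have -> : (fun z => \sum_(i < 0) f i z) = cst 0.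
    by apply/funext => z; rewrite big_ord0.
  have -> : (fun z => \sum_(i < 0) df i z) = 0.
    by apply/funext => z; rewrite big_ord0.
  exact: is_diff_cst.
have -> : (fun z => \sum_i f i z)
    = (fun z => \sum_(i < n) f (widen_ord (leqnSn n) i) z + f ord_max z).
  by apply/funext => v; rewrite big_ord_recr.
rewrite [X in is_diff _ _ X](_ : _ =
  (fun v => \sum_(i < n) df (widen_ord (leqnSn n) i) v + df ord_max v)); last first.
  by apply/funext => v; rewrite big_ord_recr.
exact: (is_diffD (IH _ _ (fun i => h _)) (h _)).
Qed.

Lemma Ck_sum V W k (A : set V) n (f : 'I_n -> V -> W) : open A ->
  (forall i, Ck k A (f i)) -> Ck k A (fun z => \sum_i f i z).
Proof.
move=> oA; elim: n f => [|n IH] f h.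
  apply: (Ck_eq oA _ (Ck_cst k A 0)) => p _.
  by rewrite big_ord0.
have -> : (fun z => \sum_i f i z)
    = (fun z => \sum_(i < n) f (widen_ord (leqnSn n) i) z + f ord_max z).
  by apply/funext => v; rewrite big_ord_recr.
by apply: CkD => //; apply: IH.
Qed.

Lemma coord_linear n i : linear (fun u : 'cV[R]_n => u i 0).
Proof. by move=> a u v; rewrite !mxE. Qed.

Lemma is_diff_cV n V W (L : 'cV[R]_n -> W) (f df : V -> 'cV[R]_n) p :
  linear L -> is_diff p f df -> is_diff p (fun z => L (f z)) (fun v => L (df v)).
Proof. by move=> lL; apply: is_diff_compL => //; exact: linear_cV_continuous. Qed.

Lemma Ck_cV n V W k (A : set V) (L : 'cV[R]_n -> W) (f : V -> 'cV[R]_n) :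
  open A -> linear L -> Ck k A f -> Ck k A (fun z => L (f z)).
Proof. by move=> oA lL; apply: Ck_lin => //; exact: linear_cV_continuous. Qed.

Lemma is_diff_dotp n V (f g df dg : V -> 'cV[R]_n) p :
  is_diff p f df -> is_diff p g dg ->
  is_diff p (fun z => dotp (f z) (g z)) (fun v => dotp (f p) (dg v) + dotp (df v) (g p)).
Proof.
move=> hf hg; under eq_fun do rewrite dotpE.
rewrite [X in is_diff _ _ X](_ : _ =
  (fun v => \sum_i (f p i 0 *: dg v i 0 + df v i 0 *: g p i 0))); last first.
  by apply/funext => v; rewrite !dotpE -big_split.
apply: is_diff_sum => i.
by apply: is_diff_scale; exact: is_diff_cV (@coord_linear n i) _.
Qed.

Lemma Ck_dotp n V k (A : set V) (f g : V -> 'cV[R]_n) : open A ->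
  Ck k A f -> Ck k A g -> Ck k A (fun z => dotp (f z) (g z)).
Proof.
move=> oA hf hg; under eq_fun do rewrite dotpE.
by apply: Ck_sum => // i; apply: CkM => //; exact: (Ck_cV oA (@coord_linear n i)).
Qed.

(** Gradients are computed throughout by exhibiting the differential as a scalar product; its values
    on the basis vectors are the partial derivatives. *)
Lemma grad_is_diff n (f : 'cV[R]_n -> R) p u : is_diff p f (dotp u) -> grad f p = u.
Proof.
by move=> h; apply/colP => i; rewrite mxE /partial (is_diff_derive _ h) dotp_delta.
Qed.

Lemma jac_is_diff n m (f df : 'cV[R]_n -> 'cV[R]_m) p v :
  linear df -> is_diff p f df -> jac f p *m v = df v.
Proof.
move=> ldf h.
pose M := GRing.isLinear.Build _ _ _ _ _ ldf.
pose F : {linear _ -> _} := HB.pack df M.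
apply/colP => i; rewrite -[df v]/(F v) [v in RHS]matrix_sum_delta linear_sum.
rewrite mxE summxE; apply: eq_bigr => j _; rewrite big_ord1 linearZ !mxE mulrC.
by rewrite /partial (is_diff_derive _ h).
Qed.
End Calculus.

(** * Differential geometry of the hemisphere chart and the canonical relation *)

Section Sphere.
Context {R : realType} {d : nat}.
Implicit Types (X Y c : 'cV[R]_(1 + d)) (x y v xi : 'cV[R]_d) (G : 'M[R]_(1 + d)).

(** Closed form of the differential of [sigma] at [xi], applied to [v]; the coefficient of [e0] is
    the differential of [rho]. *)
Definition dsigma xi v : 'cV[R]_(1 + d) := (- (dotp xi v / rho xi)) *: @e0 R d + emb v.
(** The gradient of [- rho]. *)
Definition slope xi : 'cV[R]_d := (rho xi)^-1 *: xi.
(** The differential of [slope], that is, the Hessian of [- rho] applied to [v]. *)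
Definition dslope xi v : 'cV[R]_d :=
  (rho xi)^-1 *: v + (dotp xi v / rho xi ^+ 3) *: xi.
(** The transpose of [dsigma xi], hence also the gradient at [xi] of [Sfun Y]. *)
Definition dsigma_tr xi Y : 'cV[R]_d := piv Y - first_coord Y *: slope xi.

Lemma dsigma_trP xi Y v : dotp Y (dsigma xi v) = dotp (dsigma_tr xi Y) v.
Proof.
rewrite /dsigma /dsigma_tr /slope dotpDr dotpZr dotpBl !dotpZl.
rewrite [dotp Y (e0 _ _)]dotpC dotp_e0 [dotp Y (emb _)]dotpC dotp_embl.
by rewrite [dotp v _]dotpC; ring.
Qed.

Lemma dsigma_trD xi Y Z : dsigma_tr xi (Y + Z) = dsigma_tr xi Y + dsigma_tr xi Z.
Proof. by rewrite /dsigma_tr pivD first_coordD scalerDl opprD addrACA. Qed.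

Lemma dsigma_linear xi : linear (dsigma xi).
Proof.
move=> a u v; rewrite /dsigma dotp_linear emb_linear scalerDr scalerA addrACA.
congr (_ + _); rewrite -scalerDl; congr (_ *: _).
by rewrite /GRing.scale/=; ring.
Qed.

(** Symmetry of a Hessian; this is the cancellation on which both symplecticity proofs rest. *)
Lemma dslope_sym xi v w : dotp v (dslope xi w) = dotp w (dslope xi v).
Proof.
rewrite /dslope !dotpDr !dotpZr [dotp w v]dotpC ![dotp _ xi]dotpC; ring.
Qed.

Lemma is_diff_rho xi : enorm xi < 1 ->
  is_diff xi (@rho R d) (fun v => - (dotp xi v / rho xi)).
Proof.
move=> h; have r0 := rho_gt0 h.
have hD := is_diff_dotp (is_diff_id xi) (is_diff_id xi).
have hB : is_diff xi (fun z => 1 - dotp z z) (fun v => - (2 * dotp xi v)).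
  apply: is_diff_eq (is_diff_fun_sub (is_diff_fun_cst (1 : R) xi) hD) _.
  by apply/funext => v; rewrite [dotp v xi]dotpC; ring.
have p0 : 0 < 1 - dotp xi xi by rewrite subr_gt0 -enorm_lt1.
apply: is_diff_eq (@is_diff_sqrt R _ (fun z => 1 - dotp z z) _ xi p0 hB) _.
apply/funext => v; rewrite -/(rho xi).
by field; rewrite gt_eqF.
Qed.

Lemma is_diff_sigma xi : enorm xi < 1 -> is_diff xi (@sigma R d) (dsigma xi).
Proof.
move=> h.
have -> : @sigma R d = fun z => rho z *: @e0 R d + emb z by apply/funext/sigmaE.
have h1 := is_diff_scale (is_diff_rho h) (is_diff_fun_cst (@e0 R d) xi).
have h2 := is_diff_cV emb_linear (is_diff_id xi).
apply: is_diff_eq (is_diff_fun_add h1 h2) _.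
by apply/funext => v; rewrite scaler0 add0r.
Qed.

Lemma is_diff_slope xi : enorm xi < 1 -> is_diff xi slope (dslope xi).
Proof.
move=> h; have r0 := rho_gt0 h.
have h1 := is_diff_inv (lt0r_neq0 r0) (is_diff_rho h).
apply: is_diff_eq (is_diff_scale h1 (is_diff_id xi)) _.
apply/funext => v; congr (_ + _ *: _).
by field; rewrite gt_eqF.
Qed.

Lemma is_diff_Sfun xi Y : enorm xi < 1 -> is_diff xi (Sfun Y) (dotp (dsigma_tr xi Y)).
Proof.
move=> h; apply: is_diff_eq (is_diff_cV (dotp_linear Y) (is_diff_sigma h)) _.
by apply/funext => v; rewrite dsigma_trP.
Qed.

Lemma piv_mul_linear n (M : 'M[R]_(1 + d, n)) : linear (fun X : 'cV[R]_n => piv (M *m X)).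
Proof. by move=> a u v; rewrite mulmxDr -scalemxAr piv_linear. Qed.

Lemma is_diff_gmap G xi : enorm xi < 1 ->
  is_diff xi (gmap G) (fun v => piv (G^T *m dsigma xi v)).
Proof. by move=> h; apply: is_diff_cV (piv_mul_linear _) (is_diff_sigma h). Qed.

Lemma jac_gmap G xi v : enorm xi < 1 ->
  jac (gmap G) xi *m v = piv (G^T *m dsigma xi v).
Proof.
move=> h; apply: jac_is_diff (is_diff_gmap G h).
by move=> a u w; rewrite dsigma_linear piv_mul_linear.
Qed.

(** The differential of [gmap G] is [piv] after [G^T] after [dsigma xi]; transposing reverses the
    order, and the transpose of [piv] is [emb]. *)
Lemma trmx_jac_gmap G xi y : enorm xi < 1 ->
  (jac (gmap G) xi)^T *m y = dsigma_tr xi (G *m emb y).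
Proof.
move=> h; apply: dotp_inj => v; rewrite -dsigma_trP dotp_mulmx trmxK jac_gmap//.
by rewrite dotp_mulmx dotp_embl.
Qed.

Lemma grad_Sfun Y xi : enorm xi < 1 -> grad (Sfun Y) xi = dsigma_tr xi Y.
Proof. by move=> h; apply/grad_is_diff/is_diff_Sfun. Qed.

(** The phase is affine in [x] and in [xt], with gradients [- xi] and [gmap G xi]. In [xi] it is
    [Sfun (G *m emb xt + c)] minus a linear form, so stationarity solves for [x]. *)
Lemma CanRelP G c xt eta x xi : CanRel G c ((xt, eta), (x, xi)) <->
  [/\ enorm xi < 1, eta = gmap G xi &
      x = dsigma_tr xi (G *m emb xt) + dsigma_tr xi c].
Proof.
have gx xt' xi' x' : grad (fun y => phase G c xt' xi' y) x' = - xi'.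
  apply: grad_is_diff.
  have h := is_diff_fun_sub (is_diff_fun_cst (dotp (G *m emb xt' + c) (sigma xi')) x')
    (is_diff_cV (dotp_linear xi') (is_diff_id x')).
  have -> : (fun y => phase G c xt' xi' y)
      = (fun y => dotp (G *m emb xt' + c) (sigma xi') - dotp xi' y).
    by apply/funext => y; rewrite /phase [dotp y _]dotpC.
  apply: is_diff_eq h _; apply/funext => v.
  by rewrite sub0r [RHS]dotpC dotpNr dotpC.
have gt xt' xi' x' : grad (fun y => phase G c y xi' x') xt' = gmap G xi'.
  apply: grad_is_diff.
  have -> : (fun y => phase G c y xi' x')
      = (fun y => dotp (gmap G xi') y + (dotp c (sigma xi') - dotp x' xi')).
    apply/funext => y; rewrite /phase dotpDl -addrA; congr (_ + _).
    by rewrite dotp_mulmx dotp_embl dotpC.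
  apply: is_diff_eq (is_diff_fun_add (is_diff_cV (dotp_linear _) (is_diff_id xt'))
    (is_diff_fun_cst _ xt')) _.
  by apply/funext => v; rewrite addr0.
have gxi xt' xi' x' : enorm xi' < 1 -> grad (fun z => phase G c xt' z x') xi' =
    dsigma_tr xi' (G *m emb xt') + dsigma_tr xi' c - x'.
  move=> h; apply: grad_is_diff; rewrite -dsigma_trD.
  have h1 := is_diff_fun_sub (is_diff_Sfun (G *m emb xt' + c) h)
    (is_diff_cV (dotp_linear x') (is_diff_id xi')).
  by apply: is_diff_eq h1 _; apply/funext => v; rewrite dotpBl.
rewrite /CanRel/=; split.
  move=> [xt' [xi' [x' [h [e [-> -> -> ->]]]]]].
  rewrite gx opprK gt; split=> //.
  by apply/esym/eqP; rewrite -subr_eq0 -gxi ?e.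
move=> [h -> e]; exists xt, xi, x; split=> //; split; last by rewrite gx gt opprK.
by rewrite gxi// -e subrr.
Qed.
End Sphere.

(** The images under [f] of the basis vectors are the columns of a right inverse. This turns a
    pointwise solution formula into invertibility of the Jacobian. *)
Lemma mulmx_surj_unit (F : fieldType) n (M : 'M[F]_n) (f : 'cV[F]_n -> 'cV[F]_n) :
  (forall x, M *m f x = x) -> M \in unitmx.
Proof.
move=> Mf; pose S := \matrix_(i, j) f (delta_mx j 0) i 0.
suff : M *m S = 1%:M by case/mulmx1_unit.
apply/matrixP => i j; have /colP/(_ i) := Mf (delta_mx j 0).
rewrite !mxE eqxx andbT => <-; apply: eq_bigr => l _; by rewrite mxE.
Qed.

(** * Explicit inversion of the transposed Jacobian and of [gmap] *)

Section Inverse.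
Context {R : realType} {d : nat}.
Context (G : 'M[R]_(1 + d)) (hG : G \in unitmx).
Implicit Types (X Y : 'cV[R]_(1 + d)) (x y v xi eta : 'cV[R]_d) (eps : bool).

(** A normal vector of the hyperplane [G P_0]. *)
Definition conormal : 'cV[R]_(1 + d) := invmx G^T *m @e0 R d.
Local Notation a := conormal.

Let hGt : G^T \in unitmx. Proof. by rewrite unitmx_tr. Qed.

Lemma dotp_conormal X : dotp a X = first_coord (invmx G *m X).
Proof. by rewrite dotp_mulmx trmx_inv trmxK dotp_e0. Qed.

Lemma trG_conormal : G^T *m a = @e0 R d. Proof. by rewrite mulKVmx. Qed.

Lemma dotp_conormal_gt0 : 0 < dotp a a.
Proof.
rewrite lt0r dotp_ge0 dotp_eq0 andbT; apply/eqP => a0.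
have := first_coord_e0 (R := R) (d := d).
by rewrite -trG_conormal a0 mulmx0 /first_coord !mxE => /eqP; rewrite eq_sym oner_eq0.
Qed.

Lemma GP0_conormal X : dotp a X = 0 -> GP0 G X.
Proof.
rewrite dotp_conormal => h; exists (invmx G *m X) => //.
by rewrite mulKVmx.
Qed.

(** The vector [(0, x)] is moved along [sigma xi] into the hyperplane [G P_0]; its preimage under
    [G] then has the form [(0, y)]. *)
Definition jac_sol xi x : 'cV[R]_d :=
  piv (invmx G *m (emb x - (dotp a (emb x) / dotp a (sigma xi)) *: sigma xi)).

(** [dsigma_tr xi] annihilates [sigma xi], so the correction along [sigma xi] leaves the value [x]
    unchanged. *)
Lemma jac_solP xi x : enorm xi < 1 -> dotp a (sigma xi) != 0 ->
  (jac (gmap G) xi)^T *m jac_sol xi x = x.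
Proof.
move=> h s0; rewrite trmx_jac_gmap// /jac_sol; set Y := emb x - _.
have Y0 : dotp a Y = 0 by rewrite dotpBr dotpZr divfK// subrr.
have -> : emb (piv (invmx G *m Y)) = invmx G *m Y.
  by rewrite [RHS]first_coordE -dotp_conormal Y0 scale0r add0r.
rewrite mulKVmx// /dsigma_tr /Y -scaleNr pivD pivZ piv_emb piv_sigma.
rewrite first_coordD first_coordZ first_coord_emb first_coord_sigma add0r.
rewrite /slope scalerA mulfK ?gt_eqF ?rho_gt0//.
by rewrite addrK.
Qed.

Lemma jac_unit xi : enorm xi < 1 -> dotp a (sigma xi) != 0 ->
  (jac (gmap G) xi)^T \in unitmx.
Proof. by move=> h s0; apply: mulmx_surj_unit => x; apply: jac_solP. Qed.

Lemma kappaG_sol x xi : enorm xi < 1 -> dotp a (sigma xi) != 0 ->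
  kappaG G (x, xi) = (jac_sol xi x, gmap G xi).
Proof.
move=> h s0; rewrite /kappaG/= -{1}(jac_solP x h s0) mulKmx//.
exact: jac_unit.
Qed.

Definition branch eps : R := if eps then 1 else -1.

Lemma branch_sqr eps : branch eps * branch eps = 1.
Proof. by case: eps; rewrite /branch ?mulr1// mulrNN mulr1. Qed.

Lemma DsetP eps xi :
  Dset G eps xi <-> enorm xi < 1 /\ 0 < branch eps * dotp a (sigma xi).
Proof.
rewrite /Dset/= [dotp (sigma xi) _]dotpC /branch -/conormal.
by case: eps; rewrite ?mul1r ?mulN1r ?oppr_gt0.
Qed.

(** Base point of the line of all [X] with [piv (G^T *m X) = eta]; its direction is [conormal]. *)
Definition lift_cov eta : 'cV[R]_(1 + d) := invmx G^T *m emb eta.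
(** A quarter of the discriminant, in [t], of the equation [|t a + lift_cov eta|^2 = 1], with [a]
    the conormal. *)
Definition discr eta : R := dotp a (lift_cov eta) ^+ 2
  - dotp a a * (dotp (lift_cov eta) (lift_cov eta) - 1).
(** The intersection of that line with the unit sphere at which the scalar product with [a] has the
    sign [eps], when [discr eta] is positive. *)
Definition sphere_lift eps eta : 'cV[R]_(1 + d) :=
  ((branch eps * Num.sqrt (discr eta) - dotp a (lift_cov eta)) / dotp a a) *: a
  + lift_cov eta.
(** This is the image of [Dset G eps] under [gmap G], cut out by strict inequalities so that
    openness is immediate: the line crosses the sphere at two points, and the selected one lies in
    the upper half-space. *)
Definition Eset eps : set 'cV[R]_d :=
  [set eta | 0 < discr eta /\ 0 < first_coord (sphere_lift eps eta)].

Lemma sphere_lift_gmap eps xi : Dset G eps xi ->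
  sphere_lift eps (gmap G xi) = sigma xi /\ Eset eps (gmap G xi).
Proof.
move=> /DsetP[h s0]; have aa := dotp_conormal_gt0.
set w := lift_cov (gmap G xi); set t := first_coord (G^T *m sigma xi).
(* [G^T sigma xi] is split into its two blocks and mapped back, which places [sigma xi] on the
   line. *)
have sE : sigma xi = t *: a + w.
  rewrite /w /lift_cov /gmap /conormal scalemxAr -mulmxDr -first_coordE.
  by rewrite mulKmx.
have s1 := dotp_sigma h.
(* Replacing the constant [1] by [|sigma xi|^2] makes the discriminant a perfect square. *)
have dE : discr (gmap G xi) = dotp a (sigma xi) ^+ 2.
  rewrite /discr -/w -[1]s1 sE !dotpDl !dotpDr !dotpZl !dotpZr [dotp w a]dotpC.
  ring.
have rE : Num.sqrt (discr (gmap G xi)) = branch eps * dotp a (sigma xi).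
  rewrite dE sqrtr_sqr -[RHS]gtr0_norm// normrM.
  by rewrite (_ : `|branch eps| = 1) ?mul1r// /branch; case: (eps);
     rewrite ?normrN normr1.
have lE : sphere_lift eps (gmap G xi) = sigma xi.
  rewrite /sphere_lift rE mulrA branch_sqr mul1r -/w {2}sE; congr (_ *: _ + _).
  rewrite sE dotpDr dotpZr; field.
  by rewrite gt_eqF.
split=> //; split; last by rewrite lE first_coord_sigma rho_gt0.
by rewrite dE exprn_even_gt0//=; apply: contraTneq s0 => ->; rewrite mulr0 ltxx.
Qed.

Lemma gmap_sphere_lift eps eta : Eset eps eta ->
  [/\ Dset G eps (piv (sphere_lift eps eta)),
      sigma (piv (sphere_lift eps eta)) = sphere_lift eps eta &
      gmap G (piv (sphere_lift eps eta)) = eta].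
Proof.
move=> [d0 f0]; have aa := dotp_conormal_gt0.
set X := sphere_lift eps eta in f0 *; set w := lift_cov eta.
have X1 : dotp X X = 1.
  rewrite /X /sphere_lift -/w; set r := Num.sqrt _.
  have rr : (branch eps * r) ^+ 2 = discr eta.
    by rewrite exprMn expr2 branch_sqr mul1r sqr_sqrtr// ltW.
  rewrite !dotpDl !dotpDr !dotpZl !dotpZr [dotp w a]dotpC.
  (* The scalar products are generalized, leaving a rational identity in which [b] squares to the
     discriminant. *)
  move: rr; rewrite /discr -/w.
  move: (branch eps * r) (dotp a w) (dotp w w) (dotp a a) aa => b p q n n0 rr.
  have -> : (b - p) / n * ((b - p) / n * n) + (b - p) / n * p + ((b - p) / n * p + q)
     = (b ^+ 2 - p ^+ 2) / n + q by field; rewrite gt_eqF.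
  by rewrite rr; field; rewrite gt_eqF.
have pX : 1 - dotp (piv X) (piv X) = first_coord X ^+ 2.
  by rewrite -X1 [dotp X X]dotp_split expr2 addrK.
(* Positivity of the first coordinate removes the absolute value: [X] lies on the hemisphere
   parametrized by [sigma]. *)
have rX : rho (piv X) = first_coord X by rewrite /rho pX sqrtr_sqr gtr0_norm.
have h : enorm (piv X) < 1.
  by rewrite enorm_lt1 -subr_gt0 pX exprn_gt0.
have sX : sigma (piv X) = X by rewrite sigmaE rX -first_coordE.
split=> //.
  apply/DsetP; split=> //; rewrite sX /X /sphere_lift dotpDr dotpZr divfK ?gt_eqF//.
  by rewrite subrK mulrA branch_sqr mul1r sqrtr_gt0.
rewrite /gmap sX /X /sphere_lift mulmxDr -scalemxAr trG_conormal mulKVmx//.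
by rewrite pivD pivZ piv_e0 scaler0 add0r piv_emb.
Qed.
End Inverse.

(** * Regularity of the explicit formulas *)

Section Regularity.
Context {R : realType}.
Implicit Types V W : normedModType R.

(** Continuity of [Num.sqrt] on the whole line allows openness arguments with functions defined on
    all of space. *)
Lemma Ck0_sqrt V (A : set V) (f : V -> R) : open A ->
  Ck 0 A f -> Ck 0 A (fun p => Num.sqrt (f p)).
Proof.
move=> oA /(Ck0P _ oA) hf; apply/Ck0P => // p Ap.
by apply: continuous_comp; [exact: hf|exact: sqrt_continuous].
Qed.

Lemma open_gt0 V (f : V -> R) : Ck 0 setT f -> open [set p | 0 < f p].
Proof.
move=> /(Ck0P _ openT) hf; apply: (@open_comp _ _ f [set x | 0 < x]).
  by move=> p _; exact: hf.
exact: open_gt.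
Qed.

Lemma CkB V W k (A : set V) (f g : V -> W) : open A ->
  Ck k A f -> Ck k A g -> Ck k A (fun p => f p - g p).
Proof.
move=> oA hf hg.
apply: (@Ck_eq _ _ _ _ _ (fun p => f p + (-1 : R) *: g p)) => // [p _|].
  by rewrite scaleN1r.
by apply: CkD => //; apply: CkZ => //; exact: Ck_cst.
Qed.

Lemma Ck_fst V W k (A : set (V * W)) : open A -> Ck k A (fun p => p.1).
Proof.
move=> oA; apply: (@Ck_lin _ _ _ _ _ _ (@fst V W) id) => // [p|]; first exact: cvg_fst.
exact: Ck_id.
Qed.

Lemma Ck_snd V W k (A : set (V * W)) : open A -> Ck k A (fun p => p.2).
Proof.
move=> oA; apply: (@Ck_lin _ _ _ _ _ _ (@snd V W) id) => // [p|]; first exact: cvg_snd.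
exact: Ck_id.
Qed.

Lemma mulmx_linear m n (M : 'M[R]_(m, n)) : linear (fun u : 'cV[R]_n => M *m u).
Proof. by move=> a u v; rewrite mulmxDr -scalemxAr. Qed.

Lemma open_setXT V W (N : set W) : open N -> open ([set: V] `*` N).
Proof.
move=> oN; rewrite (_ : _ `*` _ = @snd V W @^-1` N); last first.
  by apply/seteqP; split=> p /=; [case|].
by apply: open_comp => // p _; exact: cvg_snd.
Qed.

Context {d : nat} {V : normedModType R} (k : nat) (A : set V) (oA : open A).
Implicit Types (f : V -> 'cV[R]_d).

Lemma Ck_rho f : (forall p, A p -> enorm (f p) < 1) ->
  Ck k A f -> Ck k A (fun p => rho (f p)).
Proof.
move=> hb hf; apply: Ck_sqrt => // [p /hb|].
  by rewrite subr_gt0 enorm_lt1.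
by apply: CkB => //; [exact: Ck_cst|exact: Ck_dotp].
Qed.

(** Regularity of [rho] is taken as an assumption so that the lemma serves both at every order
    inside the ball and at order 0 on the whole space; [Ck_sphere_lift] treats its square root
    likewise. *)
Lemma Ck_sigma f : Ck k A (fun p => rho (f p)) -> Ck k A f ->
  Ck k A (fun p => sigma (f p)).
Proof.
move=> hr hf; under eq_fun do rewrite sigmaE.
apply: CkD => //; first by apply: CkZ => //; exact: Ck_cst.
exact: (Ck_cV oA emb_linear).
Qed.

Lemma Ck_dsigma_tr f (g : V -> 'cV[R]_(1 + d)) :
  (forall p, A p -> enorm (f p) < 1) ->
  Ck k A f -> Ck k A g -> Ck k A (fun p => dsigma_tr (f p) (g p)).
Proof.
move=> hb hf hg; apply: CkB => //; first exact: (Ck_cV oA piv_linear).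
apply: CkZ => //; first exact: (Ck_cV oA first_coord_linear).
apply: CkZ => //; apply: CkV => //; last exact: Ck_rho.
by move=> p /hb h; rewrite gt_eqF// rho_gt0.
Qed.

Context (G : 'M[R]_(1 + d)).

Lemma Ck_discr f : Ck k A f -> Ck k A (fun p => discr G (f p)).
Proof.
move=> hf.
have hl : Ck k A (fun p => lift_cov G (f p)).
  by apply: (Ck_cV oA (mulmx_linear _)); exact: (Ck_cV oA emb_linear).
have hal : Ck k A (fun p => dotp (conormal G) (lift_cov G (f p))).
  exact: (Ck_cV oA (dotp_linear _)).
apply: CkB => //; first exact: CkM.
apply: CkM => //; first exact: Ck_cst.
by apply: CkB => //; [exact: Ck_dotp|exact: Ck_cst].
Qed.

Lemma Ck_sphere_lift eps f : Ck k A f -> Ck k A (fun p => Num.sqrt (discr G (f p))) ->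
  Ck k A (fun p => sphere_lift G eps (f p)).
Proof.
move=> hf hs.
have hl : Ck k A (fun p => lift_cov G (f p)).
  by apply: (Ck_cV oA (mulmx_linear _)); exact: (Ck_cV oA emb_linear).
apply: CkD => //; apply: CkZ => //; last exact: Ck_cst.
apply: CkM => //; last exact: Ck_cst.
apply: CkB => //; last exact: (Ck_cV oA (dotp_linear _)).
by apply: CkM => //; exact: Ck_cst.
Qed.
End Regularity.

(** * Openness of the frequency domains and of the image *)

Section Opens.
Context {R : realType} {d : nat}.

Lemma open_unit_ball : open (unit_ball d : set 'cV[R]_d).
Proof.
rewrite (_ : unit_ball d = [set xi | 0 < 1 - dotp xi xi]); last first.
  by apply/seteqP; split=> xi /=; rewrite /unit_ball/= enorm_lt1 subr_gt0.
apply: open_gt0; apply: CkB; [exact: openT|exact: Ck_cst|].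
by apply: Ck_dotp; [exact: openT| |]; exact/Ck_id/openT.
Qed.

Lemma open_Dset (G : 'M[R]_(1 + d)) eps : open (Dset G eps).
Proof.
rewrite (_ : Dset G eps = unit_ball d `&`
  [set xi | 0 < branch eps * dotp (conormal G) (sigma xi)]); last first.
  by apply/seteqP; split=> xi /DsetP.
apply: openI; first exact: open_unit_ball.
have oT := @openT 'cV[R]_d.
apply: open_gt0; apply: (CkM oT); first exact: Ck_cst.
apply: (Ck_cV oT (dotp_linear _)); apply: (Ck_sigma oT); last exact: Ck_id.
apply: (Ck0_sqrt oT); apply: (CkB oT); first exact: Ck_cst.
by apply: (Ck_dotp oT); exact: Ck_id.
Qed.

Lemma open_Eset (G : 'M[R]_(1 + d)) eps : open (Eset G eps).
Proof.
have oT := @openT 'cV[R]_d.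
have hd : Ck 0 setT (fun eta => discr G eta) by apply: (Ck_discr oT); exact: Ck_id.
apply: openI; first exact: open_gt0.
apply: open_gt0; apply: (Ck_cV oT first_coord_linear).
by apply: (Ck_sphere_lift oT); [exact: Ck_id|exact: Ck0_sqrt].
Qed.
End Opens.

(** * The two canonical transformations as symplectomorphisms *)

Section Symplectic.
Context {R : realType} {d : nat}.
Local Notation phase_space := ('cV[R]_d * 'cV[R]_d)%type.
Implicit Types (x y v xi eta : 'cV[R]_d) (p q w : phase_space).

Lemma is_diff_fst p : is_diff p (fun q : phase_space => q.1) (fun w => w.1).
Proof. by apply: is_diff_lin => // q; exact: cvg_fst. Qed.

Lemma is_diff_snd p : is_diff p (fun q : phase_space => q.2) (fun w => w.2).
Proof. by apply: is_diff_lin => // q; exact: cvg_snd. Qed.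

Lemma near_open (T : topologicalType) (A : set T) (P : T -> Prop) (p : T) :
  open A -> A p -> A `<=` P -> \near p, P p.
Proof. by move=> oA Ap h; apply: filterS h _; exact: open_nbhs_nbhs. Qed.

(** The map translates each fibre by [- dS(xi)]; its inverse adds [dS(xi)] back, and symmetry of the
    Hessian of [S] preserves [omega]. *)
Lemma symplecto_kappaGam (gam : 'cV[R]_(1 + d)) :
  symplecto_onto (setT `*` unit_ball d) (setT `*` unit_ball d) (kappaGam gam).
Proof.
set A := setT `*` unit_ball d.
have oA : open A by apply/open_setXT/open_unit_ball.
have bA p : A p -> enorm p.2 < 1 by case.
have kE p : A p -> (p.1 - dsigma_tr p.2 gam, p.2) = kappaGam gam p.
  by move=> /bA h; rewrite /kappaGam grad_Sfun.
have sT k : Ck k A (fun p => dsigma_tr p.2 gam).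
  by apply: Ck_dsigma_tr => //; [exact: Ck_snd|exact: Ck_cst].
split=> //; split=> //; split=> [p [_ Ap]//|]; split.
  move=> k; apply: (Ck_eq oA kE); apply: Ck_pair => //; last exact: Ck_snd.
  by apply: CkB => //; exact: Ck_fst.
split.
  move=> p Ap w1 w2; have h := bA _ Ap.
  (* Here [dS] is [piv gam - gam_0 slope], so only the [slope] term survives differentiation. *)
  have hk : is_diff p (kappaGam gam)
      (fun w => (w.1 + first_coord gam *: dslope p.2 w.2, w.2)).
    apply: (near_eq_is_diff (near_open oA Ap kE)).
    apply: is_diff_pair (is_diff_snd p).
    have hs := is_diff_comp (is_diff_snd p) (is_diff_slope h).
    have := is_diff_scale (is_diff_fun_cst (first_coord gam) p) hs.
    move=> /(is_diff_fun_sub (is_diff_fun_cst (piv gam) p)).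
    move=> /(is_diff_fun_sub (is_diff_fst p)) h3.
    apply: is_diff_eq h3 _; apply/funext => w /=.
    by rewrite scale0r addr0 sub0r opprK.
  rewrite !(is_diff_derive _ hk) /omega /= !dotpDr !dotpZr (dslope_sym _ w2.2 w1.2).
  by rewrite opprD addrACA subrr addr0.
exists (fun q => (q.1 + dsigma_tr q.2 gam, q.2)); split.
  move=> k; apply: Ck_pair => //; last exact: Ck_snd.
  by apply: CkD => //; exact: Ck_fst.
split=> [q [_ Aq]//|]; split=> [p Ap|q Aq].
  by rewrite -kE//= subrK; case: (p).
by rewrite -kE/= ?addrK; [case: (q)|case: Aq].
Qed.

Context (G : 'M[R]_(1 + d)) (hG : G \in unitmx).

Lemma kappaG_Dset eps x xi : Dset G eps xi ->
  kappaG G (x, xi) = (jac_sol G xi x, gmap G xi).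
Proof.
move=> /DsetP[h s0]; apply: kappaG_sol => //.
by apply: contraTneq s0 => ->; rewrite mulr0 ltxx.
Qed.

(** The implicit equation of [kappaG], free of any inverse matrix; differentiation and inversion
    both start from it. *)
Lemma dsigma_tr_kappaG eps x xi : Dset G eps xi ->
  dsigma_tr xi (G *m emb (kappaG G (x, xi)).1) = x.
Proof.
move=> Dxi; rewrite (kappaG_Dset _ Dxi)/=; case/DsetP : Dxi => h s0.
rewrite -trmx_jac_gmap// jac_solP//.
by apply: contraTneq s0 => ->; rewrite mulr0 ltxx.
Qed.

(** The inverse Jacobian is traded for [jac_sol], whose only extra denominator, the product of
    [conormal] with [sigma xi], does not vanish on [Dset]. *)
Lemma smooth_kappaG eps : smooth_on (setT `*` Dset G eps) (kappaG G).
Proof.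
set A := _ `*` _ => k.
have oA : open A by apply/open_setXT/open_Dset.
have bA p : A p -> enorm p.2 < 1 by case=> _ /DsetP[].
have kE p : A p -> (jac_sol G p.2 p.1, gmap G p.2) = kappaG G p.
  by case: p => x xi [_ /kappaG_Dset ->].
apply: (Ck_eq oA kE).
have hs : Ck k A (fun p => sigma p.2).
  by apply: Ck_sigma => //; [apply: Ck_rho => //|]; exact: Ck_snd.
apply: Ck_pair => //; last exact: (Ck_cV oA (piv_mul_linear _)).
apply: (Ck_cV oA (piv_mul_linear _)).
have he : Ck k A (fun p => emb p.1) by apply: (Ck_cV oA emb_linear); exact: Ck_fst.
apply: CkB => //; apply: CkZ => //; apply: CkM => //.
  exact: (Ck_cV oA (dotp_linear _)).
apply: CkV => //; last exact: (Ck_cV oA (dotp_linear _)).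
by move=> p [_ /DsetP[_ s0]]; apply: contraTneq s0 => ->; rewrite mulr0 ltxx.
Qed.

Lemma symplectic_kappaG eps : symplectic_on (setT `*` Dset G eps) (kappaG G).
Proof.
set A := _ `*` _ => p Ap w1 w2.
have oA : open A by apply/open_setXT/open_Dset.
have h : enorm p.2 < 1 by case: Ap => _ /DsetP[].
have hk := CkS_is_diff (@smooth_kappaG eps 1) Ap.
pose Dy w : 'cV[R]_d := (derive (kappaG G) p w).1.
have hy : is_diff p (fun q => (kappaG G q).1) Dy.
  by apply: (is_diff_comp hk); apply: is_diff_lin => // q; exact: cvg_fst.
(* Only the second component is differentiated in closed form; the first derivative stays abstract
   as [Dy]. *)
have DE w : derive (kappaG G) p w = (Dy w, piv (G^T *m dsigma p.2 w.2)).
  have hg : is_diff p (kappaG G) (fun w => (Dy w, piv (G^T *m dsigma p.2 w.2))).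
    have e : (fun q => ((kappaG G q).1, gmap G q.2)) = kappaG G.
      by apply/funext => q.
    rewrite -e; apply: is_diff_pair => //.
    exact: is_diff_comp (is_diff_snd p) (is_diff_gmap G h).
  exact: is_diff_derive hg.
set c := first_coord (G *m emb (kappaG G p).1).
(* Differentiate [x = dsigma_tr xi (G *m emb y)] along [w], [y] being the first
   component of [kappaG]; the second derivative of [gmap] only enters through the
   symmetric form [dslope]. *)
have xE w : w.1 = dsigma_tr p.2 (G *m emb (Dy w)) - c *: dslope p.2 w.2.
  have lF : linear (fun y => first_coord (G *m emb y)).
    by move=> b u v; rewrite emb_linear mulmx_linear first_coord_linear.
  have lP : linear (fun y => piv (G *m emb y)).
    by move=> b u v; rewrite emb_linear mulmx_linear piv_linear.
  have hs := is_diff_comp (is_diff_snd p) (is_diff_slope h).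
  have h1 := is_diff_fun_sub (is_diff_cV lP hy) (is_diff_scale (is_diff_cV lF hy) hs).
  have h2 : is_diff p (fun q : phase_space => dsigma_tr q.2 (G *m emb (kappaG G q).1))
     (fun w => dsigma_tr p.2 (G *m emb (Dy w)) - c *: dslope p.2 w.2).
    apply: is_diff_eq h1 _; apply/funext => u /=.
    by rewrite /dsigma_tr opprD addrA addrAC.
  have e q : A q -> dsigma_tr q.2 (G *m emb (kappaG G q).1) = q.1.
    by case: q => x xi [_ /dsigma_tr_kappaG].
  have h3 := near_eq_is_diff (near_open oA Ap e) h2.
  by rewrite -(is_diff_derive w h3) (is_diff_derive w (is_diff_fst p)).
(* Transposition turns both terms of [omega] into pairings with [dsigma_tr p.2 (G *m emb (Dy w))],
   which [xE] relates to [w.1] up to the symmetric term. *)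
have sE u v : dotp (piv (G^T *m dsigma p.2 u)) v = dotp u (dsigma_tr p.2 (G *m emb v)).
  by rewrite dotpC -dotp_embl -dotp_mulmx dsigma_trP dotpC.
rewrite !DE /omega /= !sE [in RHS](xE w1) [in RHS](xE w2).
rewrite !(dotpBr _ (dsigma_tr _ _)) !(dotpZr c).
by rewrite (dslope_sym _ w2.2 w1.2) [in RHS]opprB [in RHS]addrA subrK.
Qed.

(** [sphere_lift] recovers [sigma xi] from [gmap G xi] once the sign [eps] is fixed. *)
Lemma gmap_inj eps xi xi' : Dset G eps xi -> Dset G eps xi' ->
  gmap G xi = gmap G xi' -> xi = xi'.
Proof.
move=> /(sphere_lift_gmap hG)[e _] /(sphere_lift_gmap hG)[e' _] gg.
by rewrite -(piv_sigma xi) -e gg e' piv_sigma.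
Qed.

Lemma kappaG_inj eps : {in setT `*` Dset G eps &, injective (kappaG G)}.
Proof.
move=> [x xi] [x' xi'] /set_mem[/= _ D] /set_mem[/= _ D'] e.
have exi : xi = xi' by apply: (gmap_inj D D'); case: e.
by rewrite -(dsigma_tr_kappaG x D) e exi (dsigma_tr_kappaG x' D').
Qed.

Definition kappaG_inv eps (q : phase_space) : phase_space :=
  let xi := piv (sphere_lift G eps q.2) in (dsigma_tr xi (G *m emb q.1), xi).

Lemma kappaG_invK eps p : (setT `*` Dset G eps) p ->
  kappaG_inv eps (kappaG G p) = p.
Proof.
case: p => x xi [/= _ D]; rewrite /kappaG_inv /=.
have [-> _] := sphere_lift_gmap hG D; rewrite piv_sigma.
by rewrite -[X in emb X]/(kappaG G (x, xi)).1 (dsigma_tr_kappaG x D).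
Qed.

Lemma kappaGK eps q : (setT `*` Eset G eps) q ->
  (setT `*` Dset G eps) (kappaG_inv eps q) /\ kappaG G (kappaG_inv eps q) = q.
Proof.
case: q => y eta [/= _ E]; have [D sX gX] := gmap_sphere_lift hG E.
split=> //; rewrite /kappaG_inv/=; set xi := piv _.
have [h s0] := (DsetP _ _ _).1 D.
have s0' : dotp (conormal G) (sigma xi) != 0.
  by apply: contraTneq s0 => ->; rewrite mulr0 ltxx.
by rewrite /kappaG/= -trmx_jac_gmap// mulKmx ?gX//; exact: jac_unit.
Qed.

(** The transposed Jacobian is bijective on each fibre, so the image is a full product over [Eset];
    this form makes it visibly open. *)
Lemma image_kappaG eps :
  kappaG G @` (setT `*` Dset G eps) = setT `*` Eset G eps.
Proof.
apply/seteqP; split=> [_ [[x xi] [/= _ D] <-]|q Eq].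
  by split=> //=; have [] := sphere_lift_gmap hG D.
by have [D e] := kappaGK Eq; exists (kappaG_inv eps q).
Qed.

Lemma symplecto_kappaG eps :
  symplecto_onto (setT `*` Dset G eps) (kappaG G @` (setT `*` Dset G eps)) (kappaG G).
Proof.
split; first exact/open_setXT/open_Dset.
have oE : open ([set: 'cV[R]_d] `*` Eset G eps) by apply/open_setXT/open_Eset.
rewrite image_kappaG; split=> //.
split; first by rewrite -image_kappaG => p Ap; exists p.
split; first exact: smooth_kappaG.
split; first exact: symplectic_kappaG.
exists (kappaG_inv eps); split; last first.
  split=> [q /kappaGK[]//|]; split=> [p|q /kappaGK[]//]; exact: kappaG_invK.
move=> k; set B := _ `*` _.
have hX : Ck k B (fun q => piv (sphere_lift G eps q.2)).
  apply: (Ck_cV oE piv_linear); apply: Ck_sphere_lift => //; first exact: Ck_snd.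
  (* Strict positivity of [discr] on [Eset] gives smoothness of the square root, hence of the
     inverse. *)
  apply: Ck_sqrt => // [q [_ []]//|].
  by apply: Ck_discr => //; exact: Ck_snd.
apply: Ck_pair => //; apply: Ck_dsigma_tr => //.
  by move=> q [_ /(gmap_sphere_lift hG)[/DsetP[]]].
by apply: (Ck_cV oE (mulmx_linear _)); apply: (Ck_cV oE emb_linear); exact: Ck_fst.
Qed.

End Symplectic.

Theorem theorem5p7 (R : realType) (d : nat) (hd : (0 < d)%N)
  (G : 'M[R]_(1 + d)) (hG : G \in unitmx) (gam : 'cV[R]_(1 + d)) :
  (* (i) *)
  (CanRel G 0 =
     [set q | exists (xt xi : 'cV[R]_d), enorm xi < 1 /\
        q = ((xt, gmap G xi), ((jac (gmap G) xi)^T *m xt, xi))] /\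
   forall xi0 : 'cV[R]_d, enorm xi0 < 1 -> ~ GP0 G (sigma xi0) ->
     exists N : set 'cV[R]_d, open N /\ N xi0 /\ N `<=` unit_ball d /\
       graph_on (CanRel G 0) (kappaG G) (setT `*` N) /\
       symplecto_onto (setT `*` N) (kappaG G @` (setT `*` N)) (kappaG G)) /\
  (* (ii) *)
  (graph_on (CanRel 1%:M gam) (kappaGam gam) (setT `*` unit_ball d) /\
   forall x xi : 'cV[R]_d, enorm xi < 1 ->
     kappaGam gam (x, xi) =
       (x + (first_coord gam / Num.sqrt (1 - enorm xi ^+ 2)) *: xi - piv gam, xi)) /\
  (* (iii) *)
  (forall x xi : 'cV[R]_d, enorm xi < 1 -> ~ GP0 G (sigma xi) ->
     (forall t, CanRel G gam (t, (x, xi)) <->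
        t = (invmx (jac (gmap G) xi)^T *m x
             - invmx (jac (gmap G) xi)^T *m grad (Sfun gam) xi, gmap G xi)) /\
     (invmx (jac (gmap G) xi)^T *m x
        - invmx (jac (gmap G) xi)^T *m grad (Sfun gam) xi, gmap G xi)
       = kappaG G (kappaGam gam (x, xi))) /\
  (* (iv) *)
  (symplecto_onto (setT `*` unit_ball d) (setT `*` unit_ball d) (kappaGam gam) /\
   forall eps : bool,
     {in setT `*` Dset G eps &, injective (kappaG G)} /\
     symplecto_onto (setT `*` Dset G eps) (kappaG G @` (setT `*` Dset G eps)) (kappaG G)).
Proof.
have T0 xi : dsigma_tr xi (0 : 'cV[R]_(1 + d)) = 0.
  by apply: (addIr (dsigma_tr xi 0)); rewrite -dsigma_trD !add0r.
(* Common source of the graph claims: [c = 0] for [kappaG], [c = gam] for the affine map. *)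
have graphG c x xi : enorm xi < 1 -> dotp (conormal G) (sigma xi) != 0 -> forall t,
    CanRel G c (t, (x, xi)) <->
    t = (invmx (jac (gmap G) xi)^T *m (x - dsigma_tr xi c), gmap G xi).
  move=> h s0 [xt eta]; have uJ := jac_unit hG h s0.
  rewrite CanRelP -trmx_jac_gmap//; split=> [[_ -> ->]|[-> ->]].
    by rewrite addrK mulKmx.
  by rewrite mulKVmx// subrK.
have transverse xi : ~ GP0 G (sigma xi) -> dotp (conormal G) (sigma xi) != 0.
  by move=> h; apply/eqP => /(GP0_conormal hG).
split; [split|split; [split|split; [|split]]].
- apply/seteqP; split=> [[[xt eta] [x xi]]|_ [xt [xi [h ->]]]].
    move=> /CanRelP[h -> ->]; exists xt, xi; split=> //.
    by rewrite trmx_jac_gmap// T0 addr0.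
  by apply/CanRelP; rewrite trmx_jac_gmap// T0 addr0.
- move=> xi0 h /transverse s0.
  (* The boolean records the sign at [xi0], so the neighbourhood is the whole side of [G P_0] that
     contains [xi0]. *)
  exists (Dset G (0 < dotp (conormal G) (sigma xi0))); split; first exact: open_Dset.
  split.
    apply/DsetP; split=> //; rewrite /branch.
    have [s1|s1|s1] := ltgtP 0 (dotp _ _); first by rewrite mul1r.
      by rewrite mulN1r oppr_gt0.
    by rewrite -s1 eqxx in s0.
  split; first by move=> xi /DsetP[].
  split; last exact: symplecto_kappaG.
  move=> [x xi] [_ /DsetP[hxi sxi]] t; rewrite graphG ?T0 ?subr0//.
  by apply: contraTneq sxi => ->; rewrite mulr0 ltxx.
(* For the identity matrix, [gmap] and the transposed Jacobian are both the identity, and the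
   relation reads [x = xt + dS(xi)]. *)
- move=> [x xi] [/= _ h] [xt eta]; rewrite CanRelP /kappaGam /= grad_Sfun//.
  have g1 : gmap 1%:M xi = xi by rewrite /gmap trmx1 mul1mx piv_sigma.
  have -> : dsigma_tr xi (1%:M *m emb xt) = xt.
    by rewrite mul1mx /dsigma_tr first_coord_emb scale0r subr0 piv_emb.
  split=> [[_ -> ->]|[-> ->]]; first by rewrite g1 addrK.
  by rewrite g1 subrK.
- move=> x xi h; rewrite /kappaGam/= grad_Sfun// enorm_sqr -/(rho xi).
  by rewrite /dsigma_tr /slope scalerA opprB addrA.
(* [kappaGam] fixes [xi] and [kappaG] is linear in the position, so the composition law is
   distributivity over [x - dS(xi)]. *)
- move=> x xi h /transverse s0; rewrite grad_Sfun//.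
  split=> [t|]; first by rewrite graphG// mulmxBr.
  by rewrite /kappaG /kappaGam/= grad_Sfun// [in RHS]mulmxBr.
- exact: symplecto_kappaGam.
- by move=> eps; split; [exact: kappaG_inj|exact: symplecto_kappaG].
Qed.
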